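(* Let $A\in\mathscr{B}(\mathscr{H})$. Then \[ \omega(A)^2\le \inf_{0<t<1}\left\|(1-t)|A|^{\frac{1}{1-t}}+t|A^*|^{\frac1t}\right\|. \]
   Context: $\mathscr{B}(\mathscr{H})$ is the $C^*$-algebra of all bounded linear operators on a complex Hilbert space $\mathscr{H}$ with inner product $\langle\cdot,\cdot\rangle$. For $T\in\mathscr{B}(\mathscr{H})$: $\omega(T)=\sup_{\|x\|=1}|\langle Tx,x\rangle|$ is the numerical radius and $\omega(T)^2$ means $(\omega(T))^2$; $\|T\|=\sup_{\|x\|=1}\|Tx\|$ is the operator norm; $T^*$ is the adjoint; $|T|=(T^*T)^{1/2}$. Real powers of positive operators are defined by the continuous functional calculus. *)

(* Defs.v *)
From HB Require Import structures.
From mathcomp Require Import all_boot all_order all_algebra.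
From mathcomp Require Import sesquilinear complex.
From mathcomp Require Import all_classical all_reals all_analysis.

Set Implicit Arguments.
Unset Strict Implicit.
Unset Printing Implicit Defensive.

Import Order.TTheory GRing.Theory Num.Theory.
Import numFieldNormedType.Exports.

Local Open Scope classical_set_scope.
Local Open Scope ring_scope.
Local Open Scope complex_scope.

(* The norms of H and of R[i] take their values in R[i] and are nonnegative
   reals there; their real part is the usual norm as an element of R. *)
Notation rnorm v := (complex.Re `|v|).

Section BoundedOperators.
Context {R : realType} {H : completeNormedModType R[i]}.
Implicit Types (S T : H -> H) (f : R -> R) (p : {poly R}).

(* The elements of B(H) are the maps H -> H satisfying this predicate; their
   sum, opposite and scaling are the pointwise ones, their product is \o. *)
Definition bounded_operator T : Prop :=
  linear T /\ exists M : R, forall x, rnorm (T x) <= M * rnorm x.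

(* When H is trivial the set is empty and its supremum is 0. *)
Definition opnorm T : R := sup [set rnorm (T x) | x in [set x | rnorm x = 1]].

Definition spectrum T : set R[i] :=
  [set z | ~ exists S, [/\ bounded_operator S,
     forall x, S (T x - z *: x) = x & forall x, T (S x) - z *: S x = x]].

Definition op_poly p T : H -> H :=
  fun x => \sum_(i < size p) (p`_i)%:C *: iter i T x.

(* Continuous functional calculus of a self-adjoint operator T, whose spectrum
   is real: f(T) is the norm limit of p_n(T) for polynomials p_n converging to
   f uniformly on the spectrum of T. For T self-adjoint and f continuous on the
   spectrum this limit exists and does not depend on the p_n; in the other
   cases the value is irrelevant. *)
Definition is_cfc T f S : Prop :=
  bounded_operator S /\
  exists p : nat -> {poly R},
    {uniform [set x : R | spectrum T x%:C],
       (fun n x => (p n).[x]) @ \oo --> f} /\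
    opnorm (op_poly (p n) T - S) @[n --> \oo] --> (0 : R).

Definition cfc T f : H -> H := xget 0 [set S | is_cfc T f S].

Definition op_powR T (r : R) : H -> H := cfc T (fun x => x `^ r).

End BoundedOperators.

Section HilbertOperators.
Context {R : realType} {H : completeNormedModType R[i]}.
Variable dot : {dot H for @Num.conj R[i]}.
Implicit Types S T : H -> H.

Definition numerical_radius T : R :=
  sup [set rnorm (dot (T x) x) | x in [set x | rnorm x = 1]].

Definition is_adjoint T S : Prop :=
  bounded_operator S /\ forall x y, dot (T x) y = dot x (S y).

(* For T bounded the adjoint exists (Riesz) and is unique. *)
Definition adjoint T : H -> H := xget 0 [set S | is_adjoint T S].

Definition op_abs T : H -> H := op_powR (adjoint T \o T) 2^-1.

End HilbertOperators.

(* Main.v *)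
Require Import Defs.
From mathcomp Require Import all_boot all_order all_algebra.
From mathcomp Require Import sesquilinear complex.
From mathcomp Require Import all_classical all_reals all_analysis.
From mathcomp Require Import ring lra.

(** For a unit vector x, the mixed Schwarz inequality gives
      |<A x, x>|^2 <= u v   with u = <|A| x, x> and v = <|A^*| x, x>.
    With p = 1/(1 - t) and q = 1/t, which are conjugate exponents, Young's
    inequality bounds u v by (1 - t) u^p + t v^q, and convexity of the powers
    (Hoelder-McCarthy) bounds u^p by <|A|^p x, x> and v^q by <|A^*|^q x, x>. The
    sum is <K x, x> <= |K| for the operator K in the statement. Taking the
    supremum over x and the infimum over t concludes
    (numerical_radius_powR_le).

    The operators |A|, |A|^p, |A^*| and |A^*|^q are defined by the functional
    calculus, which has to be constructed. Everything is done in the underlying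
    real Hilbert space, with the inner product Re <x, y>.

    - Minimizing a coercive quadratic functional (coercive_representation) gives
      at once the Riesz representation theorem, hence adjoints, and the inverse
      of a coercive self-adjoint operator (coercive_invertible).
    - It follows that the spectrum of a self-adjoint T is real and lies in every
      interval containing its numerical range. Factoring a polynomial over R[i]
      then shows that p(T) is invertible unless p vanishes at a spectral point;
      applied to p^2 - |p(T)|^2, this yields that |p(T)| is a value of |p| on the
      spectrum (opnorm_op_poly).
    - So polynomials converging uniformly to f on the spectrum give operators
      that converge in norm (is_cfc_cfc), and f(T) is within e of q(T) as soon as
      q is within e of f on the spectrum (cfc_approx). Order and products pass to
      the limit (is_cfc_ge, is_cfc_sqrt). The polynomials are provided by
      Bernstein's proof of the Weierstrass theorem.
    - The mixed Schwarz inequality (mixed_schwarz) follows from |A|^2 = A^* A,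
      |A^*|^2 = A A^* and A |A| = |A^*| A. *)

Set Implicit Arguments.
Unset Strict Implicit.
Unset Printing Implicit Defensive.

Import Order.TTheory GRing.Theory Num.Theory.
Import numFieldNormedType.Exports.

Local Open Scope classical_set_scope.
Local Open Scope ring_scope.
Local Open Scope complex_scope.

(** * Elementary estimates *)

Section RealEstimates.
Context {R : realType}.
Implicit Types a b c e : R.

(** Having e <= 1 at hand absorbs the terms in e ^+ 2 of an estimate. *)
Lemma le_epsM (K a b : R) : 0 <= K ->
  (forall e, 0 < e -> e <= 1 -> a <= b + K * e) -> a <= b.
Proof.
move=> K0 le_ab; apply/ler_addgt0Pr => e e0.
have K1 : 0 < K + 1 by rewrite ltr_wpDl.
have d0 : 0 < Num.min 1 (e / (K + 1)) by rewrite lt_min ltr01 divr_gt0.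
apply: le_trans (le_ab _ d0 _) _; first by rewrite ge_min lexx.
rewrite lerD2l; apply: (@le_trans _ _ (K * (e / (K + 1)))).
  by rewrite ler_wpM2l// ge_min lexx orbT.
by rewrite mulrCA ler_piMr ?(ltW e0)// ler_pdivrMr// mul1r lerDl.
Qed.

Lemma div_natS_small (C e : R) : 0 <= C -> 0 < e ->
  exists N, forall n, (N <= n)%N -> C / n.+1%:R <= e.
Proof.
move=> C0 e0; exists (Num.truncn (C / e)) => n Nn.
rewrite ler_pdivrMr ?ltr0n// [leRHS]mulrC -ler_pdivrMr//.
by apply: le_trans (ltW (truncnS_gt _)) _; rewrite ler_nat ltnS.
Qed.

Lemma discriminant_le (a b c : R) : 0 <= c ->
  (forall s, 0 <= a + 2 * s * b + s ^+ 2 * c) -> b ^+ 2 <= a * c.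
Proof.
rewrite le_eqVlt => /predU1P[<- q0|c0 q0].
  have [->|b0] := eqVneq b 0; first by rewrite expr0n mulr0.
  have := q0 (- (a + 1) / (2 * b)).
  have -> : a + 2 * (- (a + 1) / (2 * b)) * b + (- (a + 1) / (2 * b)) ^+ 2 * 0 = -1.
    by field.
  by rewrite oppr_ge0 ler10.
have := q0 (- b / c).
have -> : a + 2 * (- b / c) * b + (- b / c) ^+ 2 * c = (a * c - b ^+ 2) / c.
  by field; rewrite gt_eqF.
by rewrite pmulr_lge0 ?invr_gt0// subr_ge0.
Qed.

End RealEstimates.

(** * Uniform polynomial approximation of powers *)

Section Weierstrass.
Context {R : realType}.
Implicit Types (g h : nat -> R) (x M : R) (f : R -> R).

(** The Bernstein polynomial sum_k C(n, k) g(k) X^k (1 - X)^(n - k), by de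
    Casteljau's recursion, which turns every moment computation into a one-line
    induction without binomial sums. *)
Fixpoint bernstein (n : nat) g : {poly R} :=
  if n is m.+1 then (1 - 'X) * bernstein m g + 'X * bernstein m (g \o succn)
  else (g 0%N)%:P.

Lemma bernsteinS n g x : (bernstein n.+1 g).[x] =
  (1 - x) * (bernstein n g).[x] + x * (bernstein n (g \o succn)).[x].
Proof. by rewrite /= !hornerE. Qed.

Lemma ler_bernstein n g h x : 0 <= x <= 1 ->
  (forall k, (k <= n)%N -> g k <= h k) ->
  (bernstein n g).[x] <= (bernstein n h).[x].
Proof.
move=> /andP[x0 x1]; elim: n g h => [|n IH] g h gh.
  by rewrite /= !hornerE gh.
rewrite !bernsteinS lerD ?ler_wpM2l ?subr_ge0 ?IH // => k kn; apply: gh => //.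
exact: leqW.
Qed.

Lemma bernstein_affine n g (a b : R) x :
  (bernstein n (fun k => a + b * g k)).[x] = a + b * (bernstein n g).[x].
Proof.
elim: n g => [|n IH] g; first by rewrite /= !hornerE.
rewrite !bernsteinS IH.
have -> : (fun k => a + b * g k) \o succn = (fun k => a + b * (g \o succn) k).
  by [].
rewrite IH; ring.
Qed.

(** Mean and variance of the binomial law in one formula; the shift a is what
    makes the induction on n go through. *)
Lemma bernstein_sqr n (a : R) x :
  (bernstein n (fun k => (k%:R + a) ^+ 2)).[x] =
  (n%:R * x + a) ^+ 2 + n%:R * (x * (1 - x)).
Proof.
elim: n a => [|n IH] a; first by rewrite /= !hornerE; ring.
rewrite bernsteinS IH.
have -> : (fun k => (k%:R + a) ^+ 2) \o succn =
          (fun k => (k%:R + (1 + a)) ^+ 2).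
  by apply/funext => k /=; rewrite -natr1 addrA.
rewrite IH -natr1; ring.
Qed.

(** The modulus that Chebyshev's estimate needs; it holds for every function
    that is bounded and uniformly continuous on [0, M]. *)
Definition quadratic_modulus M f := forall e : R, 0 < e -> exists2 C : R, 0 <= C &
  forall x y : R, 0 <= x <= M -> 0 <= y <= M -> `|f x - f y| <= e + C * (x - y) ^+ 2.

(** Weierstrass: by the modulus, the value at s of the Bernstein polynomial of
    f differs from f(s) by at most e plus C times the variance, which is
    O(1/n). *)
Lemma weierstrass M f : 0 < M -> quadratic_modulus M f ->
  forall e : R, 0 < e ->
  exists p : {poly R}, forall x, 0 <= x <= M -> `|p.[x] - f x| <= e.
Proof.
move=> M0 fmod e e0; have e20 : 0 < e / 2 by rewrite divr_gt0.
have [C C0 HC] := fmod _ e20.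
have [n n0 Hn] : exists2 n, (0 < n)%N & C * M ^+ 2 / n%:R <= e / 2.
  exists (Num.truncn (C * M ^+ 2 / (e / 2))).+1 => //.
  rewrite ler_pdivrMr ?ltr0n// [leRHS]mulrC -ler_pdivrMr//.
  by rewrite ltW// truncnS_gt.
have nR0 : 0 < n%:R :> R by rewrite ltr0n.
pose g k := f (M * k%:R / n%:R).
exists (bernstein n g \Po (M^-1 *: 'X)) => x /andP[x0 xM].
rewrite horner_comp !hornerE mulrC; set s := x / M.
have s0 : 0 <= s by rewrite divr_ge0// ltW.
have s1 : s <= 1 by rewrite ler_pdivrMr// mul1r.
have s01 : 0 <= s <= 1 by rewrite s0.
have xE : x = M * s by rewrite mulrC divfK// gt_eqF.
pose D := C * M ^+ 2 / n%:R ^+ 2.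
have D0 : 0 <= D by rewrite /D divr_ge0 ?sqr_ge0// mulr_ge0 ?sqr_ge0.
have gf k : (k <= n)%N ->
    `|f x - g k| <= e / 2 + D * (k%:R + - (n%:R * s)) ^+ 2.
  move=> kn; have -> : D * (k%:R + - (n%:R * s)) ^+ 2 =
      C * (x - M * k%:R / n%:R) ^+ 2.
    by rewrite /D xE; field; rewrite gt_eqF.
  apply: HC; first by rewrite x0.
  rewrite divr_ge0 ?mulr_ge0 ?ler0n ?(ltW M0)//= ler_pdivrMr//.
  by rewrite ler_wpM2l ?ler_nat// (ltW M0).
have var : D * (bernstein n (fun k => (k%:R + - (n%:R * s)) ^+ 2)).[s] <= e / 2.
  apply: le_trans Hn; rewrite bernstein_sqr addrN expr0n/= add0r.
  have -> : D * (n%:R * (s * (1 - s))) = C * M ^+ 2 / n%:R * (s * (1 - s)).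
    by rewrite /D; field; rewrite gt_eqF.
  rewrite ler_piMr//; first by rewrite divr_ge0 ?mulr_ge0 ?sqr_ge0// ltW.
  by rewrite mulr_ile1// ?subr_ge0// gerBl.
have up := @ler_bernstein n g
  (fun k => (f x + e / 2) + D * (k%:R + - (n%:R * s)) ^+ 2) s s01.
have lo := @ler_bernstein n
  (fun k => (f x - e / 2) + (- D) * (k%:R + - (n%:R * s)) ^+ 2) g s s01.
rewrite bernstein_affine in up; rewrite bernstein_affine mulNr in lo.
rewrite ler_distl; apply/andP; split.
  set Q := D * _ in var lo.
  suff : f x - e / 2 - Q <= (bernstein n g).[s] by lra.
  by apply: lo => k kn; have := gf k kn; rewrite ler_norml; lra.
set Q := D * _ in var up.
suff : (bernstein n g).[s] <= f x + e / 2 + Q by lra.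
by apply: up => k kn; have := gf k kn; rewrite ler_norml; lra.
Qed.

End Weierstrass.

Section Powers.
Context {R : realType}.
Implicit Types (p s u M : R).

(** The graph of a convex power lies above its tangents; this is Young's
    inequality for s * u `^ (p - 1). *)
Lemma powR_tangent p s u : 1 < p -> 0 <= s -> 0 <= u ->
  u `^ p + p * u `^ (p - 1) * (s - u) <= s `^ p.
Proof.
move=> p1 s0 u0; have p0 : 0 < p by lra.
have q0 : 0 < p / (p - 1) by rewrite divr_gt0// subr_gt0.
have := @conjugate_powR _ s (u `^ (p - 1)) p (p / (p - 1)) s0 (powR_ge0 _ _) p0 q0.
have -> : p^-1 + (p / (p - 1))^-1 = 1 by field; lra.
rewrite -powRrM.
have -> : (p - 1) * (p / (p - 1)) = p by field; lra.
have uE : u `^ p = u * u `^ (p - 1).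
  rewrite -{2}(powRr1 u0) -powRD; first by congr (_ `^ _); ring.
  by rewrite addrC subrK gt_eqF.
move=> /(_ erefl).
have -> : s `^ p / p + u `^ p / (p / (p - 1)) = (s `^ p + u `^ p * (p - 1)) / p.
  by field; lra.
rewrite ler_pdivlMr// => H.
rewrite uE in H *; lra.
Qed.

Lemma powR_lipschitz p M : 1 < p -> 0 <= M -> forall s u,
  0 <= s <= M -> 0 <= u <= M -> `|s `^ p - u `^ p| <= p * M `^ (p - 1) * `|s - u|.
Proof.
move=> p1 M0; suff H s u : 0 <= s <= u -> u <= M ->
    `|s `^ p - u `^ p| <= p * M `^ (p - 1) * `|s - u|.
  move=> s u sM uM; have [su|us] := leP s u.
    by apply: H; lra.
  by rewrite distrC [in leRHS]distrC; apply: H; lra.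
move=> /andP[s0 su] uM.
have sup : s `^ p <= u `^ p by apply: ge0_ler_powR; rewrite ?nnegrE; lra.
have t := @powR_tangent p s u p1 s0 (le_trans s0 su).
have uMp : u `^ (p - 1) <= M `^ (p - 1).
  by apply: ge0_ler_powR; rewrite ?nnegrE; lra.
rewrite distrC ger0_norm ?subr_ge0// distrC ger0_norm ?subr_ge0//.
have : p * u `^ (p - 1) * (u - s) <= p * M `^ (p - 1) * (u - s).
  by rewrite ler_wpM2r ?ler_wpM2l; lra.
lra.
Qed.

(** The constant comes from the inequality L d <= e + L^2 d^2 / (4 e) between
    arithmetic and geometric means. *)
Lemma powR_modulus p M : 1 < p -> 0 <= M ->
  quadratic_modulus M (fun x => x `^ p).
Proof.
move=> p1 M0 e e0; set L := p * M `^ (p - 1).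
exists (L ^+ 2 / (4 * e)); first by rewrite divr_ge0 ?sqr_ge0//; lra.
move=> x y xM yM; apply: le_trans (powR_lipschitz p1 M0 xM yM) _.
rewrite -/L -subr_ge0 -(real_normK (num_real (x - y))).
have -> : e + L ^+ 2 / (4 * e) * `|x - y| ^+ 2 - L * `|x - y| =
          (2 * e - L * `|x - y|) ^+ 2 / (4 * e) by field; lra.
by rewrite divr_ge0 ?sqr_ge0//; lra.
Qed.

(** The square root is 1/2-Hoelder, which bounds its oscillation h by
    h <= e + h^4 / e^3. *)
Lemma sqrt_modulus M : quadratic_modulus M (fun x : R => x `^ 2^-1).
Proof.
move=> e e0; exists (e ^- 3); first by rewrite invr_ge0 exprn_ge0// ltW.
move=> x y /andP[x0 _] /andP[y0 _]; rewrite !powR12_sqrt//.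
set a := Num.sqrt x; set b := Num.sqrt y.
have a0 : 0 <= a := sqrtr_ge0 _; have b0 : 0 <= b := sqrtr_ge0 _.
have xE : x = a ^+ 2 by rewrite sqr_sqrtr.
have yE : y = b ^+ 2 by rewrite sqr_sqrtr.
rewrite xE yE; set h := `|a - b|; have h0 : 0 <= h by rewrite normr_ge0.
have hab : h <= a + b by rewrite /h ler_norml; lra.
have [he|eh] := leP h e.
  by rewrite ler_wpDr// mulr_ge0 ?sqr_ge0// invr_ge0 exprn_ge0// ltW.
have h2 : h ^+ 4 <= (a ^+ 2 - b ^+ 2) ^+ 2.
  have -> : (a ^+ 2 - b ^+ 2) ^+ 2 = h ^+ 2 * (a + b) ^+ 2.
    by rewrite real_normK ?num_real//; ring.
  by rewrite (exprD h 2 2) ler_wpM2l ?sqr_ge0// ler_sqr// nnegrE addr_ge0.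
rewrite ler_wpDl ?(ltW e0)// mulrC ler_pdivlMr ?exprn_gt0//.
apply: le_trans h2; rewrite (exprS h 3) ler_wpM2l//.
by rewrite lerXn2r ?nnegrE ?(ltW e0) ?(ltW eh).
Qed.

End Powers.

(** * Complex Hilbert spaces *)

Section Norms.
Context {R : realType}.

Lemma Re_realM (a : R) (z : R[i]) : complex.Re (a%:C * z) = a * complex.Re z.
Proof. by case: z => u v /=; rewrite mul0r subr0. Qed.

Lemma normcE_re (V : normedZmodType R[i]) (v : V) : `|v| = (rnorm v)%:C.
Proof. by rewrite RRe_real// ger0_real. Qed.

Lemma rnorm_ge0 (V : normedZmodType R[i]) (v : V) : 0 <= rnorm v.
Proof. by rewrite -ler0c -normcE_re. Qed.

Lemma rnorm_eq0 (V : normedZmodType R[i]) (v : V) : (rnorm v == 0) = (v == 0).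
Proof. by rewrite -[RHS]normr_eq0 [in RHS]normcE_re eq_complex/= eqxx andbT. Qed.

Lemma rnorm0 (V : normedZmodType R[i]) : rnorm (0 : V) = 0.
Proof. by rewrite normr0. Qed.

Lemma rnorm_gt0 (V : normedZmodType R[i]) (v : V) : (0 < rnorm v) = (v != 0).
Proof. by rewrite lt_def rnorm_eq0 rnorm_ge0 andbT. Qed.

Lemma ler_rnormD (V : normedZmodType R[i]) (u v : V) :
  rnorm (u + v) <= rnorm u + rnorm v.
Proof.
by rewrite -lecR -normcE_re rmorphD/= -!normcE_re ler_normD.
Qed.

Lemma rnormN (V : normedZmodType R[i]) (v : V) : rnorm (- v) = rnorm v.
Proof. by rewrite normrN. Qed.

Lemma rdistC (V : normedZmodType R[i]) (u v : V) : rnorm (u - v) = rnorm (v - u).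
Proof. by rewrite distrC. Qed.

Lemma rnormZ (V : normedModType R[i]) (z : R[i]) (v : V) :
  rnorm (z *: v) = rnorm z * rnorm v.
Proof.
by rewrite normrZ {1}(normcE_re z) Re_realM.
Qed.

Lemma rnormR (a : R) : rnorm a%:C = `|a|.
Proof. by rewrite normc_def /= expr0n /= addr0 sqrtr_sqr. Qed.

Lemma rnormZR (V : normedModType R[i]) (a : R) (v : V) :
  rnorm (a%:C *: v) = `|a| * rnorm v.
Proof. by rewrite rnormZ rnormR. Qed.

Lemma phase (z : R[i]) : exists2 u : R[i], rnorm u = 1 & u * z = (rnorm z)%:C.
Proof.
have [->|z0] := eqVneq z 0.
  by exists 1; rewrite ?rnorm0 ?mulr0// normr1.
exists (`|z| / z); last by rewrite divfK// normcE_re.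
by rewrite normrM normr_id normfV mulfV// normr_eq0.
Qed.

End Norms.

Section Completeness.
Context {R : realType} {V : completeNormedModType R[i]}.

(** The norm of V takes its values in R[i], so that its balls have complex
    radii; this is where real distances take over. *)
Lemma rcauchy_cvg (u : nat -> V) :
  (forall e : R, 0 < e -> exists N, forall m n, (N <= m)%N -> (N <= n)%N ->
     rnorm (u m - u n) <= e) ->
  exists l, forall e : R, 0 < e -> exists N, forall n, (N <= n)%N ->
     rnorm (u n - l) <= e.
Proof.
move=> uC; have /cauchy_cvgP/cvg_ex[l ul] : cauchy (u @ \oo).
  apply/cauchyP => e e0.
  have [eE er0] : e = (complex.Re e)%:C /\ 0 < complex.Re e.
    have eE : e = (complex.Re e)%:C by rewrite RRe_real// gtr0_real.
    by split => //; rewrite -ltcR -eE.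
  have [N uN] := uC _ (divr_gt0 er0 (ltr0Sn _ 1)).
  exists (u N); exists N => // n /= Nn.
  rewrite -ball_normE /= normcE_re eE ltcR.
  apply: le_lt_trans (uN _ _ (leqnn N) Nn) _.
  by rewrite ltr_pdivrMr// ltr_pMr// ltr1n.
exists l => e e0.
have /(ul _)[N _ uN] : nbhs l (ball l e%:C).
  by apply: nbhsx_ballx; rewrite ltcR.
exists N => n Nn; have := uN n Nn.
by rewrite /= -ball_normE /= normcE_re ltcR rdistC => /ltW.
Qed.

End Completeness.

Section Hilbert.
Context {R : realType} {H : completeNormedModType R[i]}.
Context (dot : {dot H for @Num.conj R[i]}).
Context (dot_norm : forall x : H, dot x x = `|x| ^+ 2).
Implicit Types (x y z v : H) (S T : H -> H) (a b c e M : R) (p q : {poly R}).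

(** The real inner product underlying dot: it has the same norm and the same
    self-adjoint operators, and spares all conjugations. *)
Definition rdot x y : R := complex.Re (dot x y).

Lemma dotC x y : dot x y = (dot y x)^*.
Proof. by rewrite hermC expr0 mul1r. Qed.

Lemma rdotC x y : rdot x y = rdot y x.
Proof. by rewrite /rdot dotC; case: (dot y x). Qed.

Lemma rdotDl x y z : rdot (x + y) z = rdot x z + rdot y z.
Proof. by rewrite /rdot linearDl raddfD. Qed.

Lemma rdotDr x y z : rdot x (y + z) = rdot x y + rdot x z.
Proof. by rewrite rdotC rdotDl !(rdotC x). Qed.

Lemma rdotNl x y : rdot (- x) y = - rdot x y.
Proof. by rewrite /rdot linearNl raddfN. Qed.

Lemma rdotNr x y : rdot x (- y) = - rdot x y.
Proof. by rewrite rdotC rdotNl rdotC. Qed.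

Lemma rdotBl x y z : rdot (x - y) z = rdot x z - rdot y z.
Proof. by rewrite rdotDl rdotNl. Qed.

Lemma rdotBr x y z : rdot x (y - z) = rdot x y - rdot x z.
Proof. by rewrite rdotDr rdotNr. Qed.

Lemma rdotZl a x y : rdot (a%:C *: x) y = a * rdot x y.
Proof. by rewrite /rdot linearZl_LR /=; rewrite Re_realM. Qed.

Lemma rdotZr a x y : rdot x (a%:C *: y) = a * rdot x y.
Proof. by rewrite rdotC rdotZl rdotC. Qed.

Lemma rdot0l y : rdot 0 y = 0.
Proof. by rewrite -(subrr y) rdotBl subrr. Qed.

Lemma rdot0r y : rdot y 0 = 0.
Proof. by rewrite rdotC rdot0l. Qed.

Definition rdotE := (rdotDl, rdotDr, rdotBl, rdotBr, rdotNl, rdotNr, rdotZl,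
  rdotZr, rdot0l, rdot0r).

Lemma rdotxx x : rdot x x = rnorm x ^+ 2.
Proof. by rewrite /rdot dot_norm [in LHS]normcE_re -rmorphXn. Qed.

Lemma rdot_inj x y : (forall z, rdot z x = rdot z y) -> x = y.
Proof.
move=> xy; apply/eqP; rewrite -subr_eq0 -rnorm_eq0 -sqrf_eq0 -rdotxx.
by rewrite rdotBr xy subrr.
Qed.

(** Multiplication by the imaginary unit recovers dot from its real part. *)
Lemma dot_rdot x y z t :
  (forall w, rdot (w *: x) y = rdot (w *: z) t) -> dot x y = dot z t.
Proof.
move=> E; have := E 1; have := E (- 'i%C); rewrite !scale1r /rdot !linearZl_LR /=.
case: (dot x y) => a b; case: (dot z t) => c d /=; simpc.
by rewrite ?oppr0 ?mul0r ?mul1r ?mulN1r ?add0r ?sub0r ?opprK => -> ->.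
Qed.

Section Linear.
Variable T : H -> H.
Hypothesis linT : linear T.

Lemma linD : {morph T : x y / x + y}.
Proof. by move=> x y; rewrite -[x]scale1r linT !scale1r. Qed.

Lemma lin0 : T 0 = 0.
Proof. by apply: (addrI (T 0)); rewrite -linD !addr0. Qed.

Lemma linZ (z : R[i]) x : T (z *: x) = z *: T x.
Proof. by rewrite -[z *: x]addr0 linT lin0 addr0. Qed.

Lemma linN : {morph T : x / - x}.
Proof. by move=> x; rewrite -scaleN1r linZ scaleN1r. Qed.

Lemma linB : {morph T : x y / x - y}.
Proof. by move=> x y; rewrite linD linN. Qed.

Lemma lin_sum n (F : 'I_n -> H) : T (\sum_(i < n) F i) = \sum_(i < n) T (F i).
Proof. by apply: (big_morph T linD lin0). Qed.

End Linear.

(** * Coercive forms: Riesz representation, adjoints, inverses *)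

(** For T linear over R[i] this amounts to self-adjointness for dot, by
    dot_rdot. *)
Definition self_adjoint T := forall x y, rdot (T x) y = rdot x (T y).
Definition nonneg_op T := forall x, 0 <= rdot (T x) x.

(** The form of a nonnegative operator is a semi-inner product; T = id is the
    usual inequality. *)
Lemma cauchy_schwarz_op T : linear T -> self_adjoint T -> nonneg_op T ->
  forall x y, rdot (T x) y ^+ 2 <= rdot (T x) x * rdot (T y) y.
Proof.
move=> linT saT T0 x y; apply: discriminant_le => // s.
apply: le_trans (T0 (x + s%:C *: y)) _.
rewrite (linD linT) (linZ linT) !rdotE (saT y) (rdotC y) le_eqVlt.
by apply/orP; left; apply/eqP; ring.
Qed.

Lemma ler_rdot x y : `|rdot x y| <= rnorm x * rnorm y.
Proof.
rewrite -ler_sqr ?nnegrE ?mulr_ge0 ?rnorm_ge0// real_normK ?num_real//.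
rewrite exprMn -!rdotxx; apply: (@cauchy_schwarz_op id) => // z.
by rewrite rdotxx sqr_ge0.
Qed.

Lemma bounded_operator_ge0 T : bounded_operator T ->
  exists2 M : R, 0 <= M & forall x, rnorm (T x) <= M * rnorm x.
Proof.
move=> [_ [M TM]]; exists `|M| => // x; apply: le_trans (TM x) _.
by rewrite ler_wpM2r ?rnorm_ge0 ?ler_norm.
Qed.

(** A coercive self-adjoint form represents every bounded functional f: a
    sequence x_n minimizing J = <T x, x> - 2 f(x) is Cauchy by the parallelogram
    identity, and near-minimality along the line x_n + s x bounds the derivative
    of J at x_n through a discriminant. *)
Lemma coercive_representation T c (f : H -> R) :
  bounded_operator T -> self_adjoint T -> 0 < c ->
  (forall x, c * rnorm x ^+ 2 <= rdot (T x) x) ->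
  {morph f : x y / x + y} -> (forall a x, f (a%:C *: x) = a * f x) ->
  (exists K : R, forall x, `|f x| <= K * rnorm x) ->
  exists z, forall x, rdot (T z) x = f x.
Proof.
move=> bT saT c0 Tc fD fZ [K fK]; have linT := bT.1.
have [M M0 TM] := bounded_operator_ge0 bT.
pose J x := rdot (T x) x - 2 * f x.
have J_line u x s : J (u + s%:C *: x) =
    J u + 2 * s * (rdot (T u) x - f x) + s ^+ 2 * rdot (T x) x.
  rewrite /J fD fZ (linD linT) (linZ linT) !rdotE (saT x) (rdotC x); ring.
(* The parallelogram identity for the form of T. *)
have J_mid u v : J u + J v - 2 * J (2^-1%:C *: (u + v)) =
    2^-1 * rdot (T (u - v)) (u - v).
  rewrite /J fZ fD (linZ linT) (linB linT) (linD linT) !rdotE.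
  by field.
have J_lb : has_lbound (range J).
  exists (- (K ^+ 2 / c)) => _ [x _ <-].
  have := Tc x; have := fK x; rewrite ler_norml => /andP[_ fx] cx.
  suff : - (K ^+ 2 / c) <= c * rnorm x ^+ 2 - 2 * (K * rnorm x).
    by rewrite /J; lra.
  rewrite -subr_ge0.
  have -> : c * rnorm x ^+ 2 - 2 * (K * rnorm x) - - (K ^+ 2 / c) =
     (c * rnorm x - K) ^+ 2 / c by field; rewrite gt_eqF.
  by rewrite divr_ge0 ?sqr_ge0// ltW.
have J_inf : has_inf (range J) by split => //; exists (J 0); exists 0.
set m := inf (range J).
have mJ x : m <= J x by apply: ge_inf => //; exists x.
have [u Hu] : {u : nat -> H & forall n, J (u n) <= m + 1 / n.+1%:R}.
  apply: (@choice _ _ (fun n x => J x <= m + 1 / n.+1%:R)) => n.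
  have n0 : 0 < 1 / n.+1%:R :> R by rewrite divr_gt0.
  have [_ [x _ <-] /ltW Jx] := inf_adherent n0 J_inf.
  by exists x.
clearbody m; clear J_inf J_lb; clearbody J.
have [z uz] : exists z, forall e : R, 0 < e ->
    exists N, forall n, (N <= n)%N -> rnorm (u n - z) <= e.
  apply: rcauchy_cvg => e e0.
  have [N HN] := @div_natS_small R 1 (c * e ^+ 2 / 4) ler01
    (divr_gt0 (mulr_gt0 c0 (exprn_gt0 2 e0)) (ltr0Sn _ 3)).
  exists N => i j /HN Ni /HN Nj; rewrite -ler_sqr ?nnegrE ?rnorm_ge0 ?(ltW e0)//.
  rewrite -(ler_pM2l c0).
  have := J_mid (u i) (u j); have := mJ (2^-1%:C *: (u i + u j)).
  have := Hu i; have := Hu j; have := Tc (u i - u j).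
  move: Ni Nj; set a := 1 / _; set b := 1 / _; set r := c * rnorm _ ^+ 2.
  set t := rdot _ _; set j1 := J _; set j2 := J _; set j3 := J _.
  set h := c * _.
  lra.
exists z => x; apply/eqP; rewrite -subr_eq0 -normr_le0.
have C0 : 0 <= rdot (T x) x by apply: le_trans (Tc x); rewrite mulr_ge0 ?sqr_ge0 ?ltW.
apply: (@le_epsM R (1 + M * rnorm x)) => [|e e0 _].
  by rewrite addr_ge0 ?mulr_ge0 ?rnorm_ge0.
have [N1 HN1] := uz e e0.
have [N2 HN2] := @div_natS_small R _ (e ^+ 2) C0 (exprn_gt0 2 e0).
pose n := maxn N1 N2.
have {HN1}un := HN1 n (leq_maxl _ _); have {HN2}Cn := HN2 n (leq_maxr _ _).
have bn : `|rdot (T (u n)) x - f x| <= e.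
  rewrite -ler_sqr ?nnegrE ?(ltW e0)// real_normK ?num_real//.
  apply: le_trans Cn; rewrite -[X in _ <= X / _]mul1r mulrAC; apply: discriminant_le => // s.
  have := mJ (u n + s%:C *: x); rewrite J_line; have := Hu n.
  set k := 1 / _; set j := J _; set l := 2 * s * _; set w := s ^+ 2 * _; lra.
have -> : rdot (T z) x - f x =
    (rdot (T (u n)) x - f x) - rdot (T (u n - z)) x.
  by rewrite (linB linT) !rdotE; ring.
rewrite add0r mulrDl mul1r; apply: le_trans (ler_normB _ _) _; apply: lerD => //.
apply: le_trans (ler_rdot _ _) _; rewrite mulrAC ler_wpM2r ?rnorm_ge0//.
by apply: le_trans (TM _) _; rewrite ler_wpM2l.
Qed.

(** Riesz representation is the coercive case T = id; it represents
    <T x, y> as a function of x. *)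
Lemma adjoint_exists T : bounded_operator T -> exists S, is_adjoint dot T S.
Proof.
move=> bT; have linT := bT.1; have [M M0 TM] := bounded_operator_ge0 bT.
have bid : bounded_operator (id : H -> H).
  by split=> //; exists 1 => x; rewrite mul1r.
have [S HS] : {S : H -> H & forall y x, rdot (S y) x = rdot (T x) y}.
  apply: (@choice _ _ (fun y z => forall x, rdot z x = rdot (T x) y)) => y.
  apply: (@coercive_representation id 1 (fun x => rdot (T x) y)) => //.
  - by move=> x; rewrite mul1r rdotxx.
  - by move=> u v; rewrite (linD linT) rdotDl.
  - by move=> a x; rewrite (linZ linT) rdotZl.
  - exists (M * rnorm y) => x; apply: le_trans (ler_rdot _ _) _.
    by rewrite mulrAC ler_wpM2r ?rnorm_ge0.
have dotS x y : dot (T x) y = dot x (S y).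
  by apply: dot_rdot => w; rewrite -(linZ linT) -HS rdotC.
exists S; split => //; split; last first.
  exists M => y; have [->|Sy0] := eqVneq (S y) 0.
    by rewrite rnorm0 mulr_ge0 ?rnorm_ge0.
  have Sy_gt0 : 0 < rnorm (S y) by rewrite rnorm_gt0.
  rewrite -(ler_pM2r Sy_gt0) -expr2 -rdotxx HS; apply: le_trans (ler_norm _) _.
  apply: le_trans (ler_rdot _ _) _.
  by rewrite mulrAC ler_wpM2r ?rnorm_ge0.
move=> z u v; apply: rdot_inj => w.
rewrite /rdot; congr (complex.Re _).
by rewrite linearDr/= linearZr_LR/= -!dotS linearDr/= linearZr_LR.
Qed.

Lemma adjointP T : bounded_operator T -> is_adjoint dot T (adjoint dot T).
Proof. by move=> /adjoint_exists; exact: xgetPex. Qed.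

Lemma rdot_adjoint T x y : bounded_operator T ->
  rdot (T x) y = rdot x (adjoint dot T y).
Proof. by move=> /adjointP[_ E]; rewrite /rdot E. Qed.

Definition invertible T := exists S, [/\ bounded_operator S,
  forall x, S (T x) = x & forall x, T (S x) = x].

(** Representing <y, .> by the form of T solves T z = y; coercivity makes T
    bounded below by c, hence injective with inverse bounded by 1 / c. *)
Lemma coercive_invertible T c : bounded_operator T -> self_adjoint T -> 0 < c ->
  (forall x, c * rnorm x ^+ 2 <= rdot (T x) x) -> invertible T.
Proof.
move=> bT saT c0 Tc; have linT := bT.1.
have Tlow x : c * rnorm x <= rnorm (T x).
  have [->|x0] := eqVneq x 0; first by rewrite (lin0 linT) !rnorm0 mulr0.
  have nx : 0 < rnorm x by rewrite rnorm_gt0.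
  rewrite -(ler_pM2r nx) -mulrA -expr2; apply: le_trans (Tc x) _.
  by apply: le_trans (ler_norm _) _; exact: ler_rdot.
have Tinj x y : T x = T y -> x = y.
  move=> xy; apply/eqP; rewrite -subr_eq0 -rnorm_eq0 eq_le rnorm_ge0 andbT.
  by rewrite -(pmulr_rle0 _ c0) (le_trans (Tlow _))// (linB linT) xy subrr rnorm0.
have [S TS] : {S : H -> H & forall y, T (S y) = y}.
  apply: (@choice _ _ (fun y z => T z = y)) => y.
  have [] := @coercive_representation T c (fun x => rdot y x) bT saT c0 Tc.
  - by move=> u v; rewrite rdotDr.
  - by move=> a x; rewrite rdotZr.
  - by exists (rnorm y) => x; exact: ler_rdot.
  by move=> z Hz; exists z; apply: rdot_inj => x; rewrite rdotC Hz rdotC.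
exists S; split => //; last by move=> x; apply: Tinj; rewrite TS.
split; first by move=> a u v; apply: Tinj; rewrite linT !TS.
exists c^-1 => x; rewrite -(ler_pM2l c0) mulrA mulfV ?gt_eqF// mul1r.
by have := Tlow (S x); rewrite TS.
Qed.

(** * Operator norm and polynomials in an operator *)

Lemma opnorm_ub T : bounded_operator T ->
  forall x, rnorm (T x) <= opnorm T * rnorm x.
Proof.
move=> bT x; have [M M0 TM] := bounded_operator_ge0 bT; have linT := bT.1.
have [->|x0] := eqVneq x 0; first by rewrite (lin0 linT) !rnorm0 mulr0.
have nx : 0 < rnorm x by rewrite rnorm_gt0.
rewrite -ler_pdivrMr// mulrC.
have -> : (rnorm x)^-1 * rnorm (T x) = rnorm (T ((rnorm x)^-1%:C *: x)).
  by rewrite (linZ linT) rnormZR ger0_norm// invr_ge0 ltW.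
apply: ub_le_sup.
  by exists M => _ [y /= y1 <-]; apply: le_trans (TM y) _; rewrite y1 mulr1.
exists ((rnorm x)^-1%:C *: x) => //=.
by rewrite rnormZR ger0_norm ?invr_ge0 ?ltW// mulVf// gt_eqF.
Qed.

Lemma opnorm_le T M : 0 <= M -> (forall x, rnorm (T x) <= M * rnorm x) ->
  opnorm T <= M.
Proof.
move=> M0 TM; rewrite /opnorm; set A := [set _ | _ in _].
have [->|A0] := eqVneq A set0; first by rewrite sup0.
apply: ge_sup; first exact/set0P.
by move=> _ [x /= x1 <-]; apply: le_trans (TM x) _; rewrite x1 mulr1.
Qed.

Lemma opnorm_ge0 T : 0 <= opnorm T.
Proof.
rewrite /opnorm; set A := [set _ | _ in _].
have [supA|/sup_out->//] := pselect (has_sup A).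
have [x x1] : [set x : H | rnorm x = 1] !=set0.
  by have [[_ [x x1 _]] _] := supA; exists x.
by apply: le_trans (rnorm_ge0 (T x)) _; apply: sup_upper_bound => //; exists x.
Qed.

Lemma bounded_id : bounded_operator (id : H -> H).
Proof. by split=> //; exists 1 => x; rewrite mul1r. Qed.

Lemma bounded_comp S T :
  bounded_operator S -> bounded_operator T -> bounded_operator (S \o T).
Proof.
move=> bS bT; have [M M0 SM] := bounded_operator_ge0 bS.
have [N N0 TN] := bounded_operator_ge0 bT.
split; first by move=> a x y /=; rewrite bT.1 bS.1.
exists (M * N) => x /=; apply: le_trans (SM _) _.
by rewrite -mulrA ler_wpM2l.
Qed.

Lemma bounded_add S T :
  bounded_operator S -> bounded_operator T -> bounded_operator (S + T).
Proof.
move=> bS bT; have [M M0 SM] := bounded_operator_ge0 bS.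
have [N N0 TN] := bounded_operator_ge0 bT.
split; first by move=> a x y; rewrite !fctE bT.1 bS.1 scalerDr addrACA.
exists (M + N) => x; rewrite fctE; apply: le_trans (ler_rnormD _ _) _.
by rewrite mulrDl lerD.
Qed.

Lemma bounded_scale (z : R[i]) T : bounded_operator T -> bounded_operator (z *: T).
Proof.
move=> bT; have [M M0 TM] := bounded_operator_ge0 bT.
split; first by move=> a x y; rewrite !fctE bT.1 scalerDr !scalerA (mulrC z).
exists (rnorm z * M) => x; rewrite fctE rnormZ -mulrA ler_wpM2l//.
exact: rnorm_ge0.
Qed.

Lemma bounded_opp T : bounded_operator T -> bounded_operator (- T).
Proof. by move=> bT; rewrite -scaleN1r; exact: bounded_scale. Qed.

Lemma bounded_sub S T :
  bounded_operator S -> bounded_operator T -> bounded_operator (S - T).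
Proof. by move=> bS /bounded_opp; exact: bounded_add. Qed.

(** Spectra of operators are studied through factorizations over R[i], whence
    polynomials with complex coefficients. *)
Definition op_cpoly (p : {poly R[i]}) T : H -> H :=
  fun x => \sum_(i < size p) p`_i *: iter i T x.

Section OpPoly.
Variable T : H -> H.
Hypothesis bT : bounded_operator T.
Let linT : linear T := bT.1.
Implicit Types (r s : {poly R[i]}) (d : R[i]).

Lemma op_cpoly_widen n r x : (size r <= n)%N ->
  op_cpoly r T x = \sum_(i < n) r`_i *: iter i T x.
Proof.
move=> rn; rewrite /op_cpoly (big_ord_widen n (fun i => r`_i *: iter i T x) rn).
rewrite [RHS](bigID (fun i : 'I_n => (i < size r)%N))/= [X in _ + X]big1 ?addr0//.
by move=> i; rewrite -leqNgt => /leq_sizeP/(_ _ (leqnn _)) ->; rewrite scale0r.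
Qed.

Lemma op_cpolyD r s x : op_cpoly (r + s) T x = op_cpoly r T x + op_cpoly s T x.
Proof.
rewrite (op_cpoly_widen x (size_polyD r s)).
rewrite (@op_cpoly_widen (maxn (size r) (size s)) r x (leq_maxl _ _)).
rewrite (@op_cpoly_widen (maxn (size r) (size s)) s x (leq_maxr _ _)).
by rewrite -big_split; apply: eq_bigr => i _ /=; rewrite coefD scalerDl.
Qed.

Lemma op_cpolyMX r x : op_cpoly (r * 'X) T x = op_cpoly r T (T x).
Proof.
have rX : (size (r * 'X)%R <= (size r).+1)%N.
  by apply: leq_trans (size_polyMleq _ _) _; rewrite size_polyX addn2.
rewrite (op_cpoly_widen x rX) big_ord_recl coefMX eqxx scale0r add0r.
by apply: eq_bigr => i _; rewrite coefMX /= -iterS iterSr.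
Qed.

Lemma op_cpolyZ d r x : op_cpoly (d *: r) T x = d *: op_cpoly r T x.
Proof.
rewrite (op_cpoly_widen x (size_scale_leq d r)) /op_cpoly scaler_sumr.
by apply: eq_bigr => i _; rewrite coefZ scalerA.
Qed.

Lemma op_cpolyC d x : op_cpoly d%:P T x = d *: x.
Proof.
by rewrite (op_cpoly_widen x (size_polyC_leq1 d)) big_ord1 coefC.
Qed.

Lemma op_cpoly1 x : op_cpoly 1 T x = x.
Proof. by rewrite -[1]/(1%:P) op_cpolyC scale1r. Qed.

Lemma op_cpolyX x : op_cpoly 'X T x = T x.
Proof. by rewrite -['X]mul1r -polyC1 op_cpolyMX op_cpolyC scale1r. Qed.

Lemma op_cpolyXsubC d x : op_cpoly ('X - d%:P) T x = T x - d *: x.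
Proof.
by rewrite op_cpolyD op_cpolyX -scaleN1r op_cpolyZ op_cpolyC scaleN1r.
Qed.

Lemma op_cpoly_consE r d :
  op_cpoly (r * 'X + d%:P) T = op_cpoly r T \o T + d *: id.
Proof.
by apply/funext => x; rewrite op_cpolyD op_cpolyMX op_cpolyC !fctE.
Qed.

Lemma op_cpoly_bounded r : bounded_operator (op_cpoly r T).
Proof.
elim/poly_ind: r => [|r d IH].
  rewrite -[0]/(0%:P) (_ : op_cpoly _ _ = 0 *: id).
    exact/bounded_scale/bounded_id.
  by apply/funext => x; rewrite op_cpolyC.
rewrite op_cpoly_consE; apply: bounded_add; first exact: bounded_comp.
exact/bounded_scale/bounded_id.
Qed.

Lemma op_cpolyM r s x : op_cpoly (r * s) T x = op_cpoly r T (op_cpoly s T x).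
Proof.
have linr : linear (op_cpoly r T) := (op_cpoly_bounded r).1.
elim/poly_ind: s x => [|s d IH] x.
  by rewrite mulr0 -polyC0 !op_cpolyC !scale0r (lin0 linr).
rewrite mulrDr mulrA !op_cpolyD !op_cpolyMX IH mulrC mul_polyC op_cpolyZ.
by rewrite op_cpolyC (linD linr) (linZ linr).
Qed.

End OpPoly.

Lemma op_polyE p T : op_poly p T = op_cpoly (map_poly (real_complex R) p) T.
Proof.
apply/funext => x; rewrite /op_poly /op_cpoly size_map_poly.
by apply: eq_bigr => i _; rewrite coef_map.
Qed.

Section RealOpPoly.
Variable T : H -> H.
Hypothesis bT : bounded_operator T.
Let linT : linear T := bT.1.

Lemma op_polyD p q x : op_poly (p + q) T x = op_poly p T x + op_poly q T x.
Proof. by rewrite !op_polyE rmorphD op_cpolyD. Qed.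

Lemma op_polyZ a p x : op_poly (a *: p) T x = a%:C *: op_poly p T x.
Proof. by rewrite !op_polyE map_polyZ op_cpolyZ. Qed.

Lemma op_polyB p q x : op_poly (p - q) T x = op_poly p T x - op_poly q T x.
Proof. by rewrite op_polyD -scaleN1r op_polyZ rmorphN1 scaleN1r. Qed.

Lemma op_polyC a x : op_poly a%:P T x = a%:C *: x.
Proof. by rewrite op_polyE map_polyC op_cpolyC. Qed.

Lemma op_polyM p q x : op_poly (p * q) T x = op_poly p T (op_poly q T x).
Proof. by rewrite !op_polyE rmorphM op_cpolyM. Qed.

Lemma op_polyX x : op_poly 'X T x = T x.
Proof. by rewrite op_polyE map_polyX op_cpolyX. Qed.

Lemma op_poly_bounded p : bounded_operator (op_poly p T).
Proof. by rewrite op_polyE; exact: op_cpoly_bounded. Qed.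

Lemma op_poly_commute p x : op_poly p T (T x) = T (op_poly p T x).
Proof. by rewrite -op_polyX -op_polyM mulrC op_polyM op_polyX. Qed.

Lemma op_poly_self_adjoint p : self_adjoint T -> self_adjoint (op_poly p T).
Proof.
move=> saT; elim/poly_ind: p => [|p a IH] x y.
  by rewrite -polyC0 !op_polyC !rdotE.
rewrite !op_polyD !op_polyM !op_polyX !op_polyC !rdotE IH.
by rewrite saT op_poly_commute.
Qed.

End RealOpPoly.

(** * The spectrum of a self-adjoint operator *)

Lemma invertible_comp S T : invertible S -> invertible T -> invertible (S \o T).
Proof.
move=> [S' [bS' S'S SS']] [T' [bT' T'T TT']]; exists (T' \o S').
by split=> [|x|x] /=; [exact: bounded_comp|rewrite S'S|rewrite TT'].
Qed.

Lemma invertible_scale (z : R[i]) : z != 0 -> invertible (z *: id : H -> H).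
Proof.
move=> z0; exists (z^-1 *: id); split=> [|x|x].
- exact/bounded_scale/bounded_id.
- by rewrite !fctE scalerA mulVf// scale1r.
- by rewrite !fctE scalerA mulfV// scale1r.
Qed.

(** If W inverts S T, then W commutes with T, so that W S is a two-sided
    inverse of T. *)
Lemma invertible_factor S T : bounded_operator S ->
  (forall x, S (T x) = T (S x)) -> invertible (S \o T) -> invertible T.
Proof.
move=> bS ST [W [bW WST STW]]; exists (W \o S).
have TW x : T (W x) = W (T x).
  by rewrite -{1}[T (W x)]WST/= ST; have /= -> := STW x.
split=> [|x|x]; first exact: bounded_comp.
- exact: WST.
- by rewrite /= TW -ST; exact: WST.
Qed.

(** r(T) is a product of operators T - z, as R[i] is algebraically closed. *)
Lemma op_cpoly_invertible T (r : {poly R[i]}) : bounded_operator T -> r != 0 ->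
  (forall z : R[i], root r z -> invertible (fun x => T x - z *: x)) ->
  invertible (op_cpoly r T).
Proof.
move=> bT r0 rT; have [s rE] := closed_field_poly_normal r.
have {rT} : forall z : R[i], z \in s -> invertible (fun x => T x - z *: x).
  by move=> z zs; apply: rT; rewrite rE rootZ ?lead_coef_eq0// root_prod_XsubC.
have -> : op_cpoly r T =
    (lead_coef r *: id) \o op_cpoly (\prod_(z <- s) ('X - z%:P)) T.
  by apply/funext => x; rewrite {1}rE op_cpolyZ.
move=> sT; apply: invertible_comp.
  by apply: invertible_scale; rewrite lead_coef_eq0.
elim: s sT {rE} => [|z s IH] sT.
  rewrite big_nil; exists id; split=> [|x|x]; first exact: bounded_id.
    by rewrite op_cpoly1.
  by rewrite op_cpoly1.
have -> : op_cpoly (\prod_(t <- z :: s) ('X - t%:P)) T =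
    (fun x => T x - z *: x) \o op_cpoly (\prod_(t <- s) ('X - t%:P)) T.
  by apply/funext => x; rewrite big_cons (op_cpolyM bT); exact: op_cpolyXsubC.
apply: invertible_comp; first by apply: sT; rewrite mem_head.
by apply: IH => t ts; apply: sT; rewrite inE ts orbT.
Qed.

(** For z = a + ib with b <> 0, the product of T - z with its conjugate is
    (T - a)^2 + b^2, which is coercive. *)
Lemma nonreal_invertible T (z : R[i]) : bounded_operator T -> self_adjoint T ->
  complex.Im z != 0 -> invertible (fun x => T x - z *: x).
Proof.
move=> bT saT; case: z => a b /= b0; set z := (a +i* b)%C.
have linT := bT.1.
have bTz (w : R[i]) : bounded_operator (fun x => T x - w *: x).
  exact: (bounded_sub bT (bounded_scale w bounded_id)).
have TzTw (w t : R[i]) x : T (T x - w *: x) - t *: (T x - w *: x) =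
    T (T x) - (w + t) *: T x + (w * t) *: x.
  rewrite (linB linT) (linZ linT) scalerBr scalerA (mulrC t) opprB scalerDl.
  by rewrite opprD -!addrA; congr (_ + (_ + _)); rewrite addrC.
pose D x := T x - a%:C *: x.
have bD : bounded_operator D := bTz _.
have saD : self_adjoint D by move=> x y; rewrite /D !rdotE saT.
have conjE : (fun x => T x - z^*%C *: x) \o (fun x => T x - z *: x) =
    (fun x => D (D x) + (b ^+ 2)%:C *: x).
  apply/funext => x /=; rewrite /D TzTw [X in _ = X + _]TzTw -[RHS]addrA -scalerDl.
  congr (_ - _ *: _ + _ *: _); apply/eqP; rewrite eq_complex /=.
    by rewrite subrr addr0 !eqxx.
  by rewrite mulrN opprK !mul0r !mulr0 subr0 !addr0 mulrN (mulrC b a) addNr !eqxx.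
apply: (invertible_factor (bTz z^*%C)) => [x|]; first by rewrite !TzTw (addrC z) (mulrC z).
have b20 : 0 < b ^+ 2 by rewrite exprn_even_gt0.
rewrite conjE; clearbody D; apply: coercive_invertible b20 _.
- exact: (bounded_add (bounded_comp bD bD) (bounded_scale _ bounded_id)).
- by move=> x y; rewrite !rdotE saD saD.
- by move=> x; rewrite !rdotE saD !rdotxx lerDr sqr_ge0.
Qed.

Lemma spectrum_invertible T (z : R[i]) :
  spectrum T z <-> ~ invertible (fun x => T x - z *: x).
Proof. by []. Qed.

(** For x outside [a, b], one of T - x and x - T is coercive. *)
Lemma spectrum_itv T a b (x : R) : bounded_operator T -> self_adjoint T ->
  (forall v, a * rnorm v ^+ 2 <= rdot (T v) v <= b * rnorm v ^+ 2) ->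
  spectrum T x%:C -> a <= x <= b.
Proof.
move=> bT saT Tab; have bx := bounded_scale x%:C bounded_id.
have pos c (s : R) : (forall v, c * rnorm v ^+ 2 <= s * (rdot (T v) v - x * rnorm v ^+ 2)) ->
    0 < c -> s != 0 -> invertible (fun v => T v - x%:C *: v).
  move=> Tc c0 s0; pose U v := s%:C *: (T v - x%:C *: v).
  have bU : bounded_operator U := bounded_scale _ (bounded_sub bT bx).
  have : invertible U.
    apply: (coercive_invertible bU _ c0) => [u v|v].
      by rewrite !rdotE saT.
    by rewrite !rdotE rdotxx.
  apply: invertible_factor; first exact: (bounded_scale s%:C bounded_id).
  by move=> v; rewrite (linZ bT.1) scalerBr !scalerA (mulrC s%:C).
move/spectrum_invertible => xT; rewrite !leNgt; apply/andP; split; apply/negP => xa.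
  apply: xT; apply: (pos (a - x) 1); rewrite ?subr_gt0 ?oner_eq0// => v.
  by have /andP[] := Tab v; lra.
apply: xT; apply: (pos (x - b) (-1)); rewrite ?subr_gt0 ?oppr_eq0 ?oner_eq0// => v.
by have /andP[] := Tab v; lra.
Qed.

(** The factors of p over R[i] at non-real roots are invertible, so one at a real
    root is not. *)
Lemma spectrum_root T p : bounded_operator T -> self_adjoint T -> p != 0 ->
  ~ invertible (op_poly p T) -> exists2 x : R, spectrum T x%:C & p.[x] = 0.
Proof.
move=> bT saT p0 pT; apply: contrapT => noroot; apply: pT.
rewrite op_polyE; apply: op_cpoly_invertible => //; first by rewrite map_poly_eq0.
move=> z; have [z0 rz|/nonreal_invertible-/(_ _ bT saT)//] := eqVneq (complex.Im z) 0.
have zE : z = (complex.Re z)%:C by case: z z0 {rz} => u v /= ->.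
apply: contrapT => /spectrum_invertible; rewrite zE => sz; apply: noroot.
exists (complex.Re z) => //; apply/rootP.
by move: rz; rewrite {1}zE fmorph_root.
Qed.

(** For N the norm of S, a nearly maximal unit vector x of S makes
    (S^2 - N^2) x small, since its squared norm is at most
    N^2 (N^2 - |S x|^2). *)
Lemma norm_not_invertible S v : bounded_operator S -> self_adjoint S -> v != 0 ->
  ~ invertible (fun x => S (S x) - (opnorm S ^+ 2)%:C *: x).
Proof.
move=> bS saS v0 [W [bW WS _]]; set N := opnorm S in WS *.
have N0 : 0 <= N := opnorm_ge0 S.
have [M M0 WM] := bounded_operator_ge0 bW.
pose k := M ^+ 2 * N ^+ 2; have k0 : 0 <= k by rewrite mulr_ge0 ?sqr_ge0.
have kS x : rnorm x ^+ 2 <= k * (N ^+ 2 * rnorm x ^+ 2 - rnorm (S x) ^+ 2).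
  set y := S (S x) - (N ^+ 2)%:C *: x.
  have xy : rnorm x ^+ 2 <= M ^+ 2 * rnorm y ^+ 2.
    by rewrite -exprMn ler_sqr ?nnegrE ?mulr_ge0 ?rnorm_ge0// -{1}[x]WS.
  apply: le_trans xy _; rewrite /k -mulrA ler_wpM2l ?sqr_ge0//.
  have yE : rdot y y = rnorm (S (S x)) ^+ 2 - 2 * N ^+ 2 * rnorm (S x) ^+ 2 +
      N ^+ 4 * rnorm x ^+ 2.
    by rewrite -!rdotxx /y !rdotE (rdotC x) (saS (S x) x); ring.
  have SSx : rnorm (S (S x)) ^+ 2 <= N ^+ 2 * rnorm (S x) ^+ 2.
    rewrite -exprMn ler_sqr ?nnegrE ?mulr_ge0 ?rnorm_ge0//; exact: opnorm_ub.
  rewrite -rdotxx yE -subr_ge0; move: SSx; rewrite -subr_ge0.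
  by congr (0 <= _); ring.
have nv : 0 < rnorm v ^+ 2 by rewrite exprn_gt0// rnorm_gt0.
have {k0} k0 : 0 < k.
  rewrite lt_def k0 andbT; apply/eqP => kE; have := kS v.
  by rewrite kE mul0r leNgt nv.
have kS' x : rnorm (S x) ^+ 2 <= (N ^+ 2 - k^-1) * rnorm x ^+ 2.
  have := kS x; rewrite -ler_pdivrMl//; lra.
have d0 : 0 <= N ^+ 2 - k^-1.
  by rewrite -(pmulr_lge0 _ nv) (le_trans _ (kS' v))// sqr_ge0.
have : N <= Num.sqrt (N ^+ 2 - k^-1).
  apply: opnorm_le => [|x]; first exact: sqrtr_ge0.
  rewrite -ler_sqr ?nnegrE ?mulr_ge0 ?sqrtr_ge0 ?rnorm_ge0//.
  by rewrite exprMn sqr_sqrtr.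
rewrite -ler_sqr ?nnegrE ?sqrtr_ge0// sqr_sqrtr// lerBrDr gerDl leNgt.
by rewrite invr_gt0 k0.
Qed.

(** The norm of p(T) is the value of |p| at a point of the spectrum: by
    norm_not_invertible, p(T)^2 - |p(T)|^2 is not invertible. When this polynomial
    vanishes identically, any spectral point will do. *)
Lemma opnorm_op_poly T p v : bounded_operator T -> self_adjoint T -> v != 0 ->
  exists2 x : R, spectrum T x%:C & `|p.[x]| = opnorm (op_poly p T).
Proof.
move=> bT saT v0.
have noninv (r : {poly R}) :
    ~ invertible (op_poly (r ^+ 2 - (opnorm (op_poly r T) ^+ 2)%:P) T).
  have -> : op_poly (r ^+ 2 - (opnorm (op_poly r T) ^+ 2)%:P) T =
      (fun x => op_poly r T (op_poly r T x) - (opnorm (op_poly r T) ^+ 2)%:C *: x).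
    by apply/funext => x; rewrite op_polyB op_polyC; congr (_ - _); exact: op_polyM.
  apply: norm_not_invertible v0; first exact: op_poly_bounded.
  exact: op_poly_self_adjoint.
have [x sx px] : exists2 x : R, spectrum T x%:C &
    p.[x] ^+ 2 - opnorm (op_poly p T) ^+ 2 = 0.
  have [q0|q0] := eqVneq (p ^+ 2 - (opnorm (op_poly p T) ^+ 2)%:P) 0.
    have X0 : 'X^2 - (opnorm (op_poly 'X T) ^+ 2)%:P != 0 :> {poly R}.
      by rewrite -size_poly_gt0 size_XnsubC.
    have [x sx _] := spectrum_root bT saT X0 (noninv 'X).
    by exists x => //; have := congr1 (horner^~ x) q0; rewrite !hornerE.
  have [x sx px] := spectrum_root bT saT q0 (noninv p).
  by exists x => //; rewrite -px !hornerE.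
exists x => //; apply/eqP.
rewrite -(@eqrXn2 _ 2) ?opnorm_ge0// real_normK ?num_real//.
by rewrite -subr_eq0 px.
Qed.

Lemma op_poly_le T p K : bounded_operator T -> self_adjoint T ->
  (forall x : R, spectrum T x%:C -> `|p.[x]| <= K) ->
  forall v, rnorm (op_poly p T v) <= K * rnorm v.
Proof.
move=> bT saT pK v; have bp := op_poly_bounded bT p.
have [->|v0] := eqVneq v 0; first by rewrite (lin0 bp.1) !rnorm0 mulr0.
have [x /pK px pE] := opnorm_op_poly p bT saT v0.
apply: le_trans (opnorm_ub bp v) _.
by rewrite -pE ler_wpM2r ?rnorm_ge0.
Qed.

(** If 0 <= p <= m on the spectrum, then m - p(T) has norm at most m,
    which forces p(T) to be nonnegative. *)
Lemma op_poly_ge0 T p : bounded_operator T -> self_adjoint T ->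
  (forall x : R, spectrum T x%:C -> 0 <= p.[x]) -> nonneg_op (op_poly p T).
Proof.
move=> bT saT p0 v; have [M M0 TM] := bounded_operator_ge0 bT.
have sM (x : R) : spectrum T x%:C -> - M <= x <= M.
  apply: spectrum_itv => // w; rewrite mulNr -ler_norml.
  apply: le_trans (ler_rdot _ _) _.
  by rewrite expr2 mulrA ler_wpM2r ?rnorm_ge0.
have [m pm] := poly_itv_bound p (- M) M.
have mp : rnorm (op_poly (m%:P - p) T v) <= m * rnorm v.
  apply: op_poly_le => // x sx; rewrite !hornerE ger0_norm ?gerBl ?p0//.
  by rewrite subr_ge0 (le_trans (ler_norm _))// pm// sM.
have := le_trans (ler_norm _) (ler_rdot (op_poly (m%:P - p) T v) v).
have := ler_wpM2r (rnorm_ge0 v) mp.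
rewrite op_polyB op_polyC !rdotE rdotxx; lra.
Qed.

(** * Continuous functional calculus *)

Lemma uniform_cvgP (X : set R) (u : nat -> R -> R) (f : R -> R) :
  {uniform X, u @ \oo --> f} <->
  (forall e, 0 < e -> exists N, forall n, (N <= n)%N ->
     forall x : R, X x -> `|u n x - f x| <= e).
Proof.
split=> [uf e e0|uf P /uniform_nbhs[E [entE EP]]].
  have : nbhs (f : {uniform` X -> R}) [set h | forall x : R, X x -> `|h x - f x| <= e].
    apply/uniform_nbhs; exists [set xy | ball xy.1 e xy.2]; split.
      exact: entourage_ball (PosNum e0).
    by move=> h /= fh x Xx; have := fh x Xx; rewrite distrC => /ltW.
  by move=> /uf[N _ uN]; exists N.
move: entE; rewrite -entourage_ballE => -[e /= e0 eE].
have e20 : 0 < e / 2 by rewrite divr_gt0.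
have [N uN] := uf _ e20; exists N => // n Nn; apply: EP => x Xx; apply: eE => /=.
rewrite /ball /= distrC (le_lt_trans (uN n Nn x Xx))//.
by rewrite ltr_pdivrMr// ltr_pMr// ltr1n.
Qed.

(** Convergence for opnorm is traded for bounds at each vector, the form in which
    all estimates below are made. *)
Lemma is_cfcP T (f : R -> R) S : bounded_operator T -> is_cfc T f S <->
  bounded_operator S /\ exists u : nat -> {poly R}, forall e, 0 < e ->
    exists N, forall n, (N <= n)%N ->
      (forall x : R, spectrum T x%:C -> `|(u n).[x] - f x| <= e) /\
      (forall v, rnorm (op_poly (u n) T v - S v) <= e * rnorm v).
Proof.
move=> bT; split=> -[bS [u Hu]]; split=> //; exists u.
  move: Hu => [/uniform_cvgP uf /cvgrPdist_le uS] e e0.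
  have [N1 HN1] := uf e e0; have [N2 _ HN2] := uS e e0.
  exists (maxn N1 N2) => n; rewrite geq_max => /andP[n1 n2]; split.
    exact: HN1.
  move=> v; have bn : bounded_operator (op_poly (u n) T - S).
    exact: bounded_sub (op_poly_bounded bT _) bS.
  apply: le_trans (opnorm_ub bn v) _; rewrite ler_wpM2r ?rnorm_ge0//.
  by have := HN2 n n2; rewrite /= sub0r normrN; apply: le_trans; exact: ler_norm.
split.
  apply/uniform_cvgP => e e0; have [N HN] := Hu e e0.
  by exists N => n /HN[].
apply/cvgrPdist_le => e e0; have [N HN] := Hu e e0.
exists N => // n /= /HN[_ nS]; rewrite sub0r normrN ger0_norm ?opnorm_ge0//.
exact: opnorm_le (ltW e0) nS.
Qed.

Section FunctionalCalculus.
Variables (T : H -> H) (f : R -> R).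
Hypotheses (bT : bounded_operator T) (saT : self_adjoint T).

(** The approximating polynomials u_n of f satisfy |q(T) - u_n(T)| <= e + o(1),
    as the norm of a polynomial in T is governed by its values on the spectrum.
    In particular f(T) does not depend on the u_n. *)
Lemma cfc_approx S q e : is_cfc T f S ->
  (forall x : R, spectrum T x%:C -> `|q.[x] - f x| <= e) ->
  forall v, rnorm (op_poly q T v - S v) <= e * rnorm v.
Proof.
move=> /(is_cfcP _ _ bT)[bS [u uP]] qf v.
apply: (@le_epsM R (2 * rnorm v)) => [|d d0 _]; first by rewrite mulr_ge0 ?rnorm_ge0.
have [N /(_ N (leqnn N))[uf uS]] := uP d d0.
have qu : rnorm (op_poly (q - u N) T v) <= (e + d) * rnorm v.
  apply: op_poly_le => // x sx; rewrite !hornerE.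
  have := qf x sx; have := uf x sx; rewrite !ler_norml; lra.
rewrite -(subrKA (op_poly (u N) T v)); apply: le_trans (ler_rnormD _ _) _.
by have := uS v; rewrite op_polyB in qu; lra.
Qed.

(** Polynomials u_n converging uniformly to f on the spectrum give operators
    u_n(T) that are Cauchy in norm, so they converge pointwise, to a bounded
    operator, and the convergence is in norm. *)
Lemma is_cfc_cfc :
  (forall e, 0 < e -> exists q, forall x : R, spectrum T x%:C -> `|q.[x] - f x| <= e) ->
  is_cfc T f (cfc T f).
Proof.
move=> fapprox; apply: xgetPex; apply: contrapT => noS; apply: noS.
have [u uf] : {u : nat -> {poly R} & forall n (x : R), spectrum T x%:C ->
    `|(u n).[x] - f x| <= 1 / n.+1%:R}.
  apply: (@choice _ _ (fun n q => forall x : R, spectrum T x%:C ->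
    `|q.[x] - f x| <= 1 / n.+1%:R)) => n.
  by apply: fapprox; rewrite divr_gt0.
have small (e : R) : 0 < e -> exists N, forall n, (N <= n)%N ->
    forall x : R, spectrum T x%:C -> `|(u n).[x] - f x| <= e.
  move=> e0; have [N HN] := div_natS_small ler01 e0.
  by exists N => n /HN ne x sx; exact: le_trans (uf n x sx) ne.
have cau (e : R) : 0 < e -> exists N, forall m n, (N <= m)%N -> (N <= n)%N ->
    forall v, rnorm (op_poly (u m) T v - op_poly (u n) T v) <= e * rnorm v.
  move=> e0; have [N HN] := small _ (divr_gt0 e0 (ltr0Sn _ 1)).
  exists N => m n /HN Hm /HN Hn v; rewrite -op_polyB.
  apply: op_poly_le => // x sx; rewrite !hornerE.
  have := Hm x sx; have := Hn x sx; rewrite !ler_norml; lra.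
have [S uS] : {S : H -> H & forall v (e : R), 0 < e -> exists N, forall n,
    (N <= n)%N -> rnorm (op_poly (u n) T v - S v) <= e}.
  apply: (@choice _ _ (fun v w => forall e : R, 0 < e -> exists N, forall n,
    (N <= n)%N -> rnorm (op_poly (u n) T v - w) <= e)) => v.
  apply: rcauchy_cvg => e e0.
  have v1 : 0 < rnorm v + 1 by rewrite ltr_wpDl ?rnorm_ge0.
  have [N HN] := cau _ (divr_gt0 e0 v1).
  exists N => m n Nm Nn; apply: le_trans (HN m n Nm Nn v) _.
  by rewrite mulrAC ler_pdivrMr// ler_wpM2l ?(ltW e0)// lerDl.
have uSe (e : R) : 0 < e -> exists N, forall n, (N <= n)%N ->
    forall v, rnorm (op_poly (u n) T v - S v) <= e * rnorm v.
  move=> e0; have [N HN] := cau e e0; exists N => n Nn v.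
  apply: (@le_epsM R 1) => // d d0 _; have [N' HN'] := uS v d d0.
  rewrite -(subrKA (op_poly (u (maxn N N')) T v)) mul1r.
  apply: le_trans (ler_rnormD _ _) _; apply: lerD.
    by apply: HN; rewrite ?leq_maxl.
  by apply: HN'; rewrite leq_maxr.
have bu n := op_poly_bounded bT (u n).
exists S; apply/(is_cfcP _ _ bT); split; last first.
  exists u => e e0; have [N1 HN1] := small e e0; have [N2 HN2] := uSe e e0.
  exists (maxn N1 N2) => n; rewrite geq_max => /andP[n1 n2].
  by split; [exact: HN1|exact: HN2].
split; last first.
  have [N /(_ N (leqnn N)) NS] := uSe 1 ltr01.
  have [M M0 HM] := bounded_operator_ge0 (bu N).
  exists (M + 1) => v; have -> : S v = op_poly (u N) T v - (op_poly (u N) T v - S v).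
    by rewrite subKr.
  apply: le_trans (ler_rnormD _ _) _; rewrite rnormN mulrDl.
  by apply: lerD; [exact: HM|exact: NS].
move=> z x y; apply/eqP; rewrite -subr_eq0 -rnorm_eq0 eq_le rnorm_ge0 andbT.
apply: (@le_epsM R (rnorm (z *: x + y) + (rnorm z * rnorm x + rnorm y))) => [|e e0 _].
  by rewrite !addr_ge0 ?mulr_ge0 ?rnorm_ge0.
have [N /(_ N (leqnn N)) NS] := uSe e e0.
have -> : S (z *: x + y) - (z *: S x + S y) =
    (z *: (op_poly (u N) T x - S x) + (op_poly (u N) T y - S y)) -
    (op_poly (u N) T (z *: x + y) - S (z *: x + y)).
  by rewrite (bu N).1 scalerBr opprB [X in _ = X + _]addrACA -opprD [RHS]addrC subrKA.
apply: le_trans (ler_rnormD _ _) _; rewrite rnormN.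
have := ler_rnormD (z *: (op_poly (u N) T x - S x)) (op_poly (u N) T y - S y).
rewrite rnormZ; have := NS (z *: x + y); have := NS y.
have := ler_wpM2l (rnorm_ge0 z) (NS x); lra.
Qed.

End FunctionalCalculus.

Section CfcProperties.
Variables (T : H -> H) (f : R -> R) (S : H -> H).
Hypotheses (bT : bounded_operator T) (saT : self_adjoint T).
Hypothesis cfcS : is_cfc T f S.

Lemma is_cfc_approx e : 0 < e -> exists q,
  (forall x : R, spectrum T x%:C -> `|q.[x] - f x| <= e) /\
  (forall v, rnorm (op_poly q T v - S v) <= e * rnorm v).
Proof.
move=> e0; have /(is_cfcP _ _ bT)[_ [u uP]] := cfcS.
by have [N /(_ N (leqnn N))] := uP e e0; exists (u N).
Qed.

Lemma is_cfc_self_adjoint : self_adjoint S.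
Proof.
move=> x y; apply/eqP; rewrite -subr_eq0 -normr_le0.
apply: (@le_epsM R (2 * (rnorm x * rnorm y))) => [|e e0 _].
  by rewrite !mulr_ge0 ?rnorm_ge0.
have [q [_ qS]] := is_cfc_approx e0.
have -> : rdot (S x) y - rdot x (S y) =
    rdot x (op_poly q T y - S y) - rdot (op_poly q T x - S x) y.
  by rewrite !rdotE (op_poly_self_adjoint bT q saT x y); ring.
apply: le_trans (ler_normB _ _) _.
have := ler_rdot x (op_poly q T y - S y).
have := ler_rdot (op_poly q T x - S x) y.
have := ler_wpM2l (rnorm_ge0 x) (qS y); have := ler_wpM2r (rnorm_ge0 y) (qS x).
lra.
Qed.

(** A polynomial q within e of f on the spectrum satisfies q - g + e >= 0
    there. *)
Lemma is_cfc_ge g : (forall x : R, spectrum T x%:C -> g.[x] <= f x) ->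
  forall v, rdot (op_poly g T v) v <= rdot (S v) v.
Proof.
move=> gf v; apply: (@le_epsM R (2 * rnorm v ^+ 2)) => [|e e0 _].
  by rewrite mulr_ge0 ?sqr_ge0.
have [q [qf qS]] := is_cfc_approx e0.
have : 0 <= rdot (op_poly (q - g + e%:P) T v) v.
  apply: op_poly_ge0 => // x sx; rewrite !hornerE.
  by have := qf x sx; have := gf x sx; rewrite ler_norml; lra.
have := le_trans (ler_norm _) (ler_rdot (op_poly q T v - S v) v).
have := ler_wpM2r (rnorm_ge0 v) (qS v).
rewrite op_polyD op_polyB op_polyC !rdotE rdotxx; lra.
Qed.

(** Products pass to the limit as q(T) stays bounded by F + 1 when q is within
    1 of f on the spectrum. *)
Lemma is_cfc_sqrt (F : R) :
  (forall x : R, spectrum T x%:C -> `|f x| <= F) ->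
  (forall x : R, spectrum T x%:C -> f x ^+ 2 = x) ->
  forall v, S (S v) = T v.
Proof.
move=> fF ff v; have bS : bounded_operator S := cfcS.1.
have [N N0 SN] := bounded_operator_ge0 bS.
have [F0|/negP F0] := boolP (0 <= F); last first.
  have [->|v0] := eqVneq v 0; first by rewrite !(lin0 bS.1) (lin0 bT.1).
  have [x sx _] := opnorm_op_poly 0 bT saT v0.
  by case: F0; exact: le_trans (fF x sx).
apply/eqP; rewrite -subr_eq0 -rnorm_eq0 eq_le rnorm_ge0 andbT.
apply: (@le_epsM R ((N + 3 * F + 2) * rnorm v)) => [|e e0 e1].
  by rewrite mulr_ge0 ?rnorm_ge0 ?addr_ge0 ?mulr_ge0.
have [q [qf qS]] := is_cfc_approx e0.
have qF (x : R) : spectrum T x%:C -> `|q.[x]| <= F + 1.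
  move=> sx; have := qf x sx; have := fF x sx; rewrite !ler_norml; lra.
have qqT : rnorm (op_poly (q * q - 'X) T v) <= e * (2 * F + 1) * rnorm v.
  apply: op_poly_le => // x sx.
  have -> : (q * q - 'X).[x] = (q.[x] - f x) * (q.[x] + f x).
    by rewrite !hornerE -[X in _ - X](ff x sx); ring.
  rewrite normrM; apply: ler_pM => //; first exact: qf.
  apply: le_trans (ler_normD _ _) _.
  by have := qF x sx; have := fF x sx; lra.
rewrite op_polyB op_polyM// op_polyX in qqT.
have qv : rnorm (op_poly q T v) <= (F + 1) * rnorm v by exact: op_poly_le.
have Sq : rnorm (S (S v - op_poly q T v)) <= N * (e * rnorm v).
  by apply: le_trans (SN _) _; rewrite ler_wpM2l// rdistC.
have Sqq : rnorm (S (op_poly q T v) - op_poly q T (op_poly q T v)) <=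
    e * ((F + 1) * rnorm v).
  by rewrite rdistC; apply: le_trans (qS _) _; rewrite ler_wpM2l// ltW.
have -> : S (S v) - T v = S (S v - op_poly q T v) +
    (S (op_poly q T v) - op_poly q T (op_poly q T v)) +
    (op_poly q T (op_poly q T v) - T v).
  by rewrite (linB bS.1) !subrKA.
apply: le_trans (ler_rnormD _ _) _.
have := ler_rnormD (S (S v - op_poly q T v))
  (S (op_poly q T v) - op_poly q T (op_poly q T v)).
lra.
Qed.

End CfcProperties.

Lemma nonneg_spectrum T : bounded_operator T -> self_adjoint T -> nonneg_op T ->
  exists2 M : R, 0 < M & forall x : R, spectrum T x%:C -> 0 <= x <= M.
Proof.
move=> bT saT T0; have [M M0 TM] := bounded_operator_ge0 bT.
exists (M + 1) => [|x]; first by rewrite ltr_wpDl.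
apply: spectrum_itv => // v; rewrite mul0r T0/=.
apply: le_trans (ler_norm _) _; apply: le_trans (ler_rdot _ _) _.
rewrite expr2 mulrA ler_wpM2r ?rnorm_ge0//; apply: le_trans (TM v) _.
by rewrite ler_wpM2r ?rnorm_ge0// lerDl.
Qed.

Lemma is_cfc_powR T r : bounded_operator T -> self_adjoint T -> nonneg_op T ->
  (forall M : R, 0 <= M -> quadratic_modulus M (fun x : R => x `^ r)) ->
  is_cfc T (fun x : R => x `^ r) (op_powR T r).
Proof.
move=> bT saT T0 rmod; apply: is_cfc_cfc => // e e0.
have [M M0 sM] := nonneg_spectrum bT saT T0.
have [q Hq] := weierstrass M0 (rmod M (ltW M0)) e0.
by exists q => x /sM; exact: Hq.
Qed.

(** The Hoelder-McCarthy inequality: the tangent to the convex power at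
    <T v, v> is affine, hence survives the functional calculus. *)
Lemma powR_rdot_le T (r : R) v : bounded_operator T -> self_adjoint T ->
  nonneg_op T -> 1 < r -> rnorm v = 1 ->
  rdot (T v) v `^ r <= rdot (op_powR T r v) v.
Proof.
move=> bT saT T0 r1 v1; set s := rdot (T v) v.
have cfcS := is_cfc_powR bT saT T0 (fun M => @powR_modulus R r M r1).
have [M M0 sM] := nonneg_spectrum bT saT T0.
pose g : {poly R} := (r * s `^ (r - 1)) *: ('X - s%:P) + (s `^ r)%:P.
have gE : rdot (op_poly g T v) v = s `^ r.
  rewrite op_polyD op_polyZ op_polyB op_polyX !op_polyC !rdotE rdotxx v1 -/s.
  by ring.
rewrite -gE; apply: (is_cfc_ge bT saT cfcS) => x /sM/andP[x0 _].
by rewrite !hornerE addrC; apply: powR_tangent => //; exact: T0.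
Qed.

(** * The absolute value of an operator *)

Section AbsoluteValue.
Variable A : H -> H.
Hypothesis bA : bounded_operator A.
Let bA' : bounded_operator (adjoint dot A) := (adjointP bA).1.

Lemma rdot_gram x y : rdot (adjoint dot A (A x)) y = rdot (A x) (A y).
Proof. by rewrite rdotC -rdot_adjoint// rdotC. Qed.

Lemma gram_bounded : bounded_operator (adjoint dot A \o A).
Proof. exact: bounded_comp. Qed.

Lemma gram_self_adjoint : self_adjoint (adjoint dot A \o A).
Proof. by move=> x y /=; rewrite rdot_gram [in RHS]rdotC rdot_gram rdotC. Qed.

Lemma gram_nonneg : nonneg_op (adjoint dot A \o A).
Proof. by move=> x /=; rewrite rdot_gram rdotxx sqr_ge0. Qed.

Lemma is_cfc_op_abs :
  is_cfc (adjoint dot A \o A) (fun x : R => x `^ 2^-1) (op_abs dot A).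
Proof.
apply: is_cfc_powR gram_bounded gram_self_adjoint gram_nonneg _ => M _.
exact: sqrt_modulus.
Qed.

Lemma op_abs_bounded : bounded_operator (op_abs dot A).
Proof. exact: is_cfc_op_abs.1. Qed.

Lemma op_abs_self_adjoint : self_adjoint (op_abs dot A).
Proof.
exact: is_cfc_self_adjoint gram_bounded gram_self_adjoint is_cfc_op_abs.
Qed.

Lemma op_abs_nonneg : nonneg_op (op_abs dot A).
Proof.
move=> v; have := is_cfc_ge gram_bounded gram_self_adjoint is_cfc_op_abs.
move=> /(_ 0%:P _ v); rewrite op_polyC !rdotE mul0r; apply=> x _.
by rewrite hornerE powR_ge0.
Qed.

Lemma op_abs_sqr v : op_abs dot A (op_abs dot A v) = adjoint dot A (A v).
Proof.
have [M M0 sM] := nonneg_spectrum gram_bounded gram_self_adjoint gram_nonneg.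
apply: (is_cfc_sqrt gram_bounded gram_self_adjoint is_cfc_op_abs
  (F := M `^ 2^-1)) => x /sM/andP[x0 xM].
  by rewrite ger0_norm ?powR_ge0// ge0_ler_powR ?nnegrE// ltW.
by rewrite powR12_sqrt// sqr_sqrtr.
Qed.

End AbsoluteValue.

Lemma adjointK T : bounded_operator T -> adjoint dot (adjoint dot T) = T.
Proof.
move=> bT; apply/funext => x; apply: rdot_inj => z.
rewrite -rdot_adjoint; last exact: (adjointP bT).1.
by rewrite rdotC -rdot_adjoint// rdotC.
Qed.

Lemma op_poly_intertwine S T U p x : linear U -> (forall y, U (S y) = T (U y)) ->
  U (op_poly p S x) = op_poly p T (U x).
Proof.
move=> linU UST; rewrite /op_poly (lin_sum linU); apply: eq_bigr => i _.
rewrite (linZ linU); congr (_ *: _).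
by elim: (i : nat) => //= n IH; rewrite UST IH.
Qed.

(** A intertwines A^* A with A A^*, hence any polynomial in them. As 0 may
    belong to only one of the two spectra, the square root is approximated on an
    interval containing both. *)
Lemma op_abs_intertwine A v : bounded_operator A ->
  A (op_abs dot A v) = op_abs dot (adjoint dot A) (A v).
Proof.
move=> bA; have linA := bA.1; have bA' := (adjointP bA).1.
have [N N0 AN] := bounded_operator_ge0 bA.
have [M1 M10 s1] := nonneg_spectrum (gram_bounded bA) (gram_self_adjoint bA)
  (gram_nonneg bA).
have [M2 M20 s2] := nonneg_spectrum (gram_bounded bA') (gram_self_adjoint bA')
  (gram_nonneg bA').
pose M := Num.max M1 M2; have M0 : 0 < M by rewrite lt_max M10.
apply/eqP; rewrite -subr_eq0 -rnorm_eq0 eq_le rnorm_ge0 andbT.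
apply: (@le_epsM R (2 * N * rnorm v)) => [|e e0 _].
  by rewrite !mulr_ge0 ?rnorm_ge0.
have [q qM] := weierstrass M0 (@sqrt_modulus R M) e0.
have q1 := cfc_approx (gram_bounded bA) (gram_self_adjoint bA)
  (is_cfc_op_abs bA) (q := q) (e := e) _ v.
have q2 := cfc_approx (gram_bounded bA') (gram_self_adjoint bA')
  (is_cfc_op_abs bA') (q := q) (e := e) _ (A v).
set B := op_abs dot A in q1 *; set C := op_abs dot (adjoint dot A) in q2 *.
have {}q1 : rnorm (op_poly q (adjoint dot A \o A) v - B v) <= e * rnorm v.
  apply: q1 => x /s1/andP[x0 x1]; apply: qM.
  by rewrite x0 le_max x1.
have {}q2 : rnorm (op_poly q (A \o adjoint dot A) (A v) - C (A v)) <= e * rnorm (A v).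
  rewrite -{1}(adjointK bA); apply: q2 => x /s2/andP[x0 x2]; apply: qM.
  by rewrite x0 le_max x2 orbT.
have qA : op_poly q (A \o adjoint dot A) (A v) = A (op_poly q (adjoint dot A \o A) v).
  by symmetry; apply: op_poly_intertwine.
have -> : A (B v) - C (A v) = (op_poly q (A \o adjoint dot A) (A v) - C (A v)) -
    A (op_poly q (adjoint dot A \o A) v - B v).
  by rewrite (linB linA) qA opprB [RHS]addrC subrKA.
apply: le_trans (ler_rnormD _ _) _; rewrite rnormN.
have := AN (op_poly q (adjoint dot A \o A) v - B v).
have := ler_wpM2l N0 q1; have := ler_wpM2l (ltW e0) (AN v); lra.
Qed.

(** The mixed Schwarz inequality. Writing y = (|A^*| + e) w turns <A x, y> into
    <(|A| + e) x, A^* w>, to which Cauchy-Schwarz for the form of |A| + e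
    applies; what comes out is at most <|A^*| y, y>. This spares the polar
    decomposition. *)
Lemma mixed_schwarz A x y : bounded_operator A ->
  rdot (A x) y ^+ 2 <=
  rdot (op_abs dot A x) x * rdot (op_abs dot (adjoint dot A) y) y.
Proof.
move=> bA; have bA' := (adjointP bA).1.
have CA := fun v => op_abs_intertwine v bA.
have CC v := op_abs_sqr bA' v; rewrite adjointK// in CC.
have bB := op_abs_bounded bA; have saB := op_abs_self_adjoint bA.
have B0 := op_abs_nonneg bA.
have bC := op_abs_bounded bA'; have saC := op_abs_self_adjoint bA'.
have C0 := op_abs_nonneg bA'.
set B := op_abs dot A in CA bB saB B0 *.
set C := op_abs dot (adjoint dot A) in CA CC bC saC C0 *.
apply: (@le_epsM R (rnorm x ^+ 2 * rdot (C y) y)) => [|e e0 _].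
  by rewrite mulr_ge0 ?sqr_ge0.
have add_id U : bounded_operator U -> self_adjoint U ->
    bounded_operator (U + e%:C *: id) /\ self_adjoint (U + e%:C *: id).
  move=> bU saU; split; first exact: (bounded_add bU (bounded_scale _ bounded_id)).
  by move=> u v; rewrite !fctE !rdotE saU.
have [bG saG] := add_id B bB saB; have [bCe saCe] := add_id C bC saC.
have [W [_ _ CeW]] : invertible (C + e%:C *: id).
  apply: (coercive_invertible bCe saCe e0) => v.
  by rewrite fctE !rdotE rdotxx lerDr.
have [w yE] : exists w, y = C w + e%:C *: w by exists (W y); rewrite -[LHS]CeW.
have G0 : nonneg_op (B + e%:C *: id).
  by move=> v; rewrite fctE !rdotE rdotxx addr_ge0// mulr_ge0 ?sqr_ge0// ltW.
have AG u : A ((B + e%:C *: id) u) = C (A u) + e%:C *: A u.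
  by rewrite !fctE (linD bA.1) (linZ bA.1) CA.
have -> : rdot (A x) y = rdot ((B + e%:C *: id) x) (adjoint dot A w).
  by rewrite -rdot_adjoint// AG yE !rdotE saC.
apply: le_trans (cauchy_schwarz_op bG.1 saG G0 _ _) _.
have Gx : rdot ((B + e%:C *: id) x) x = rdot (B x) x + e * rnorm x ^+ 2.
  by rewrite fctE !rdotE rdotxx.
have Gw : rdot ((B + e%:C *: id) (adjoint dot A w)) (adjoint dot A w) <=
    rdot (C y) y.
  rewrite -rdot_adjoint// AG -CC yE (linD bC.1) (linZ bC.1) !rdotE.
  rewrite (saC (C (C w)) w) (saC (C w) w).
  have := C0 w; have : 0 <= rdot (C w) (C w) by rewrite rdotxx sqr_ge0.
  by move=> Cw w0; have e_ge0 := ltW e0; rewrite lerDl addr_ge0 ?mulr_ge0.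
rewrite Gx; apply: le_trans (ler_wpM2l _ Gw) _.
  by rewrite addr_ge0// mulr_ge0 ?sqr_ge0// ltW.
by rewrite mulrDl lerD2l -mulrA mulrC.
Qed.

Lemma rdot_phase u x y : rnorm u = 1 -> rdot (u *: x) (u *: y) = rdot x y.
Proof.
move=> u1; rewrite /rdot linearZl_LR linearZr_LR /= mulrA -normCK.
by rewrite [`|u|]normcE_re u1 expr1n mul1r.
Qed.

(** Turning x by a phase makes <A x, x> real and nonnegative and leaves
    the forms of both absolute values unchanged. *)
Lemma dot_sqr_le A x : bounded_operator A ->
  rnorm (dot (A x) x) ^+ 2 <=
  rdot (op_abs dot A x) x * rdot (op_abs dot (adjoint dot A) x) x.
Proof.
move=> bA; have [u u1 uz] := phase (dot (A x) x).
have -> : rnorm (dot (A x) x) = rdot (A (u *: x)) x.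
  by rewrite (linZ bA.1) /rdot linearZl_LR /= uz.
apply: le_trans (mixed_schwarz _ _ bA) _.
by rewrite (linZ (op_abs_bounded bA).1) rdot_phase.
Qed.

Lemma numerical_radius_sqr_le A K : 0 <= K ->
  (forall x, rnorm x = 1 -> rnorm (dot (A x) x) ^+ 2 <= K) ->
  numerical_radius dot A ^+ 2 <= K.
Proof.
move=> K0 AK; rewrite /numerical_radius; set X := [set _ | _ in _].
have [->|/set0P X0] := eqVneq X set0; first by rewrite sup0 expr0n.
have [x x1] : [set x : H | rnorm x = 1] !=set0 by have [_ [x x1 _]] := X0; exists x.
have Xub : ubound X (Num.sqrt K).
  move=> _ [y y1 <-].
  by rewrite -ler_sqr ?nnegrE ?sqrtr_ge0 ?rnorm_ge0// sqr_sqrtr// (AK y y1).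
have supK : sup X <= Num.sqrt K by apply: ge_sup.
have supX_ge0 : 0 <= sup X.
  apply: le_trans (rnorm_ge0 (dot (A x) x)) _.
  by apply: ub_le_sup; [exists (Num.sqrt K)|exists x].
by rewrite -[leRHS]sqr_sqrtr// ler_sqr ?nnegrE ?sqrtr_ge0.
Qed.

(** Young's inequality for the conjugate exponents 1/(1 - t) and 1/t, then
    powR_rdot_le for both factors. *)
Lemma numerical_radius_powR_le A t : bounded_operator A -> 0 < t < 1 ->
  numerical_radius dot A ^+ 2 <=
  opnorm ((1 - t)%:C *: op_powR (op_abs dot A) (1 - t)^-1 +
          t%:C *: op_powR (op_abs dot (adjoint dot A)) t^-1).
Proof.
move=> bA /andP[t0 t1]; have bA' := (adjointP bA).1.
have s0 : 0 < 1 - t by rewrite subr_gt0.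
have p1 : 1 < (1 - t)^-1 by rewrite invf_gt1// gtrBl.
have q1 : 1 < t^-1 by rewrite invf_gt1.
have bB := op_abs_bounded bA; have saB := op_abs_self_adjoint bA.
have B0 := op_abs_nonneg bA.
have bC := op_abs_bounded bA'; have saC := op_abs_self_adjoint bA'.
have C0 := op_abs_nonneg bA'.
set B := op_abs dot A in bB saB B0 *.
set C := op_abs dot (adjoint dot A) in bC saC C0 *.
have bBp : bounded_operator (op_powR B (1 - t)^-1).
  exact: (is_cfc_powR bB saB B0 (fun M => @powR_modulus R _ M p1)).1.
have bCq : bounded_operator (op_powR C t^-1).
  exact: (is_cfc_powR bC saC C0 (fun M => @powR_modulus R _ M q1)).1.
have BP x := powR_rdot_le (v := x) bB saB B0 p1.
have CQ x := powR_rdot_le (v := x) bC saC C0 q1.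
have AA x := dot_sqr_le x bA; rewrite -/B -/C in AA.
move: (op_powR B _) (op_powR C _) bBp bCq BP CQ => P Q bP bQ BP CQ.
clearbody B C; set K := (_ + _).
have bK : bounded_operator K.
  exact: (bounded_add (bounded_scale _ bP) (bounded_scale _ bQ)).
have KE x : rdot (K x) x = (1 - t) * rdot (P x) x + t * rdot (Q x) x.
  by rewrite -[K x]/((1 - t)%:C *: P x + t%:C *: Q x) !rdotE.
clearbody K.
apply: numerical_radius_sqr_le => [|x x1]; first exact: opnorm_ge0.
apply: (@le_trans _ _ (rdot (K x) x)); last first.
  apply: le_trans (ler_norm _) _; apply: le_trans (ler_rdot _ _) _.
  by rewrite x1 mulr1; have := opnorm_ub bK x; rewrite x1 mulr1.
apply: le_trans (AA x) _.
have := @conjugate_powR R _ _ (1 - t)^-1 t^-1 (B0 x) (C0 x).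
rewrite !invrK !invr_gt0 => /(_ s0 t0) young.
apply: le_trans (young _) _; first by rewrite subrK.
rewrite KE !(mulrC (_ `^ _)).
apply: lerD; rewrite ler_wpM2l ?(ltW s0) ?(ltW t0)//.
  exact: BP.
exact: CQ.
Qed.

End Hilbert.

Theorem theorem2p2 (R : realType) (H : completeNormedModType R[i])
    (dot : {dot H for @Num.conj R[i]})
    (dot_norm : forall x : H, dot x x = `|x| ^+ 2)
    (A : H -> H) (A_bounded : bounded_operator A) :
  numerical_radius dot A ^+ 2 <=
  inf [set opnorm ((1 - t)%:C *: op_powR (op_abs dot A) (1 - t)^-1 +
                   t%:C *: op_powR (op_abs dot (adjoint dot A)) t^-1)
       | t in [set t : R | 0 < t < 1]].
Proof.
apply: lb_le_inf.
  exists (opnorm ((1 - 2^-1)%:C *: op_powR (op_abs dot A) (1 - 2^-1)^-1 +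
    2^-1%:C *: op_powR (op_abs dot (adjoint dot A)) 2^-1^-1)), 2^-1 => //=.
  by rewrite invr_gt0 ltr0n invf_lt1// ltr1n.
by move=> _ [t t01 <-]; exact: numerical_radius_powR_le.
Qed.
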